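(* The bottleneck distance $d_B$ and the erosion distance $d_E$ on $\mathsf{PDgm}$ are not coarsely equivalent.
   Context: Let $\mathbb{R}^2_<=\{(b,d)\in\mathbb{R}^2: b<d\}$. A persistence diagram is a finite multiset $Y=\{(b_i,d_i)\}_{i=1}^N$ of points of $\mathbb{R}^2_<$; $\mathsf{PDgm}$ is the set of all of them. For $b\le d$, $\mathrm{rank}[Y](b,d)$ is the number (with multiplicity) of $(b_i,d_i)\in Y$ with $b_i\le b\le d<d_i$. The erosion distance $d_E(Y,Y')$ is the infimum of all $\varepsilon\ge0$ such that, for all $b\le d$, $\mathrm{rank}[Y](b-\varepsilon,d+\varepsilon)\le\mathrm{rank}[Y'](b,d)$ and $\mathrm{rank}[Y'](b-\varepsilon,d+\varepsilon)\le\mathrm{rank}[Y](b,d)$. The bottleneck distance is $$d_B(Y,Y')=\min_{\phi:S\to S'}\max\left\{\max_{(b,d)\in S}d_\infty((b,d),\phi(b,d)),\ \max_{(b,d)\in Y\setminus S}\tfrac{d-b}{2},\ \max_{(b',d')\in Y'\setminus S'}\tfrac{d'-b'}{2}\right\},$$ the minimum being over bijections $\phi$ between sub-multisets $S\subseteq Y$ and $S'\subseteq Y'$, with $d_\infty((b,d),(b',d'))=\max\{|b-b'|,|d-d'|\}$ and maxima over empty sets equal to $0$. A map $f:(X,d_X)\to(Z,d_Z)$ of metric spaces is a coarse embedding if there are non-decreasing $\rho^-,\rho^+:[0,\infty)\to[0,\infty)$ with $\lim_{t\to\infty}\rho^-(t)=\infty$ and $\rho^-(d_X(x,x'))\le d_Z(f(x),f(x'))\le\rho^+(d_X(x,x'))$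 for all $x,x'\in X$. Two metrics $d,d'$ on the same set $X$ are coarsely equivalent if the identity map is a coarse embedding $(X,d)\to(X,d')$ and also a coarse embedding $(X,d')\to(X,d)$. *)

(* Defs.v *)
From HB Require Import structures.
From mathcomp Require Import all_boot all_order all_algebra.
From mathcomp Require Import finmap multiset.
From mathcomp Require Import lra.
From mathcomp Require Import all_classical all_reals all_analysis.

Set Implicit Arguments.
Unset Strict Implicit.
Unset Printing Implicit Defensive.

Import Order.TTheory GRing.Theory Num.Theory.
Import numFieldNormedType.Exports.

Local Open Scope classical_set_scope.
Local Open Scope ring_scope.

(* R^2_<, a pair (birth, death) *)
Definition half_plane (R : realType) := {p : R * R | p.1 < p.2}.

Definition birth (R : realType) (p : half_plane R) : R := (val p).1.
Definition death (R : realType) (p : half_plane R) : R := (val p).2.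

Definition PDgm (R : realType) := {mset (half_plane R)}%mset.

(* [enum_mset Y] lists each point as many times as its multiplicity in Y. *)
Definition rank (R : realType) (Y : PDgm R) (b d : R) : nat :=
  count (fun p => (birth p <= b) && (d < death p)) (enum_mset Y).

Definition eroded (R : realType) (e : R) (Y Y' : PDgm R) : Prop :=
  forall b d : R, b <= d -> (rank Y (b - e) (d + e) <= rank Y' b d)%N.

Definition erosion_set (R : realType) (Y Y' : PDgm R) : set R :=
  [set e | [/\ 0 <= e, eroded e Y Y' & eroded e Y' Y]].

(* [inf] on R is junk (0) on the empty set; see [erosion_set_nonempty]. *)
Definition erosion_distance (R : realType) (Y Y' : PDgm R) : R :=
  inf (erosion_set Y Y').

Definition dist_infty (R : realType) (p q : half_plane R) : R :=
  Num.max `|birth p - birth q| `|death p - death q|.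

Definition half_persistence (R : realType) (p : half_plane R) : R :=
  (death p - birth p) / 2.

(* Repeated points of a multiset are told apart by their position in
   [enum_mset]: a bijection S -> S' is a bijection between positions. *)
Definition mset_index (R : realType) (S : PDgm R) := 'I_(size (enum_mset S)).

Definition mset_point (R : realType) (S : PDgm R) (i : mset_index S)
  : half_plane R := tnth (in_tuple (enum_mset S)) i.

(* All terms are nonnegative, so starting the maxima at 0 only matters for
   empty index sets. *)
Definition matching_cost (R : realType) (Y Y' S S' : PDgm R)
    (phi : mset_index S -> mset_index S') : R :=
  Num.max
    (\big[Num.max/0]_(i : mset_index S)
        dist_infty (mset_point i) (mset_point (phi i)))
    (Num.max
      (\big[Num.max/0]_(p <- enum_mset (Y `\` S)%mset) half_persistence p)
      (\big[Num.max/0]_(p <- enum_mset (Y' `\` S')%mset) half_persistence p)).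

Definition matching_costs (R : realType) (Y Y' : PDgm R) : set R :=
  [set c | exists (S S' : PDgm R) (phi : mset_index S -> mset_index S'),
     [/\ (S `<=` Y)%mset, (S' `<=` Y')%mset, bijective phi
       & c = matching_cost Y Y' phi]].

(* The infimum is a minimum: see [bottleneck_distance_attained]. *)
Definition bottleneck_distance (R : realType) (Y Y' : PDgm R) : R :=
  inf (matching_costs Y Y').

(* A non-decreasing self-map of [0, +oo), given by a map R -> R whose values at
   negative arguments are irrelevant. *)
Definition nondecreasing_control (R : realType) (rho : R -> R) : Prop :=
  (forall t, 0 <= t -> 0 <= rho t) /\
  (forall s t, 0 <= s -> s <= t -> rho s <= rho t).

Definition coarse_embedding (R : realType) (X Z : Type)
    (dX : X -> X -> R) (dZ : Z -> Z -> R) (f : X -> Z) : Prop :=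
  exists rho_m rho_p : R -> R,
    [/\ nondecreasing_control rho_m,
        nondecreasing_control rho_p,
        rho_m t @[t --> +oo] --> +oo
      & forall x x' : X,
          rho_m (dX x x') <= dZ (f x) (f x') <= rho_p (dX x x')].

Definition coarsely_equivalent (R : realType) (X : Type)
    (d d' : X -> X -> R) : Prop :=
  coarse_embedding d d' id /\ coarse_embedding d' d id.

Lemma rank_eq0 (R : realType) (Y : PDgm R) : exists2 e0 : R, 0 <= e0 &
  forall e b d, e0 <= e -> b <= d -> rank Y (b - e) (d + e) = 0%N.
Proof.
exists (\big[Num.max/0]_(p <- enum_mset Y) half_persistence p).
  exact: bigmax_ge_id.
move=> e b d e0e bd; apply/eqP; rewrite /rank -leqn0 leqNgt -has_count.
apply/hasPn => p pY; apply/negP => /andP[h1 h2].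
have : half_persistence p <= e.
  by apply: le_trans e0e; apply: (@le_bigmax_seq _ _ _ _ _ p).
by rewrite /half_persistence; lra.
Qed.

Lemma erosion_set_nonempty (R : realType) (Y Y' : PDgm R) :
  erosion_set Y Y' !=set0.
Proof.
have [e e0 eY] := rank_eq0 Y; have [e' e'0 eY'] := rank_eq0 Y'.
exists (e + e'); split; first exact: addr_ge0.
- by move=> b d bd; rewrite eY// lerDl.
- by move=> b d bd; rewrite eY'// lerDr.
Qed.

Lemma inf_attained (R : realType) (A : set R) (V : seq R) :
  A !=set0 -> (forall x, A x -> x \in V) -> A (inf A).
Proof.
move=> [a Aa] AV.
pose m := \big[Num.min/a]_(v <- V | `[< A v >]) v.
have Am : A m.
  apply: big_ind => //; last by move=> v /asboolP.
  by move=> x y Ax Ay; rewrite minEle; case: ifP.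
have lm : lbound A m.
  by move=> x Ax; apply: (@ge_bigmin_seq _ _ _ V a x); [exact: AV | exact/asboolP].
suff -> : inf A = m by [].
apply/eqP; rewrite eq_le; apply/andP; split.
  by apply: ge_inf => //; exists m.
by apply: lb_le_inf => //; exists a.
Qed.

Lemma matching_costs_nonempty (R : realType) (Y Y' : PDgm R) :
  matching_costs Y Y' !=set0.
Proof.
exists (@matching_cost R Y Y' mset0 mset0 id).
by exists mset0, mset0, id; split; rewrite ?msub0set//; exists id.
Qed.

Lemma bottleneck_distance_attained (R : realType) (Y Y' : PDgm R) :
  matching_costs Y Y' (bottleneck_distance Y Y').
Proof.
pose V : seq R := 0 :: [seq dist_infty p q | p <- enum_mset Y, q <- enum_mset Y']
  ++ [seq half_persistence p | p <- enum_mset Y ++ enum_mset Y'].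
apply: (@inf_attained _ _ V); first exact: matching_costs_nonempty.
move=> _ [S [S' [phi [SY S'Y' _ ->]]]].
have V0 : 0 \in V by rewrite inE eqxx.
have Vmax x y : x \in V -> y \in V -> Num.max x y \in V.
  by move=> xV yV; rewrite maxEle; case: ifP.
have Vh p : p \in enum_mset Y ++ enum_mset Y' -> half_persistence p \in V.
  by move=> pYY'; rewrite inE mem_cat map_f ?orbT.
rewrite /matching_cost; refine (Vmax _ _ _ (Vmax _ _ _ _)).
- apply: (big_ind (fun x : R => x \in V)) => // i _; rewrite inE mem_cat allpairs_f ?orbT//.
  + by apply: (msubset_subset SY); apply: mem_tnth.
  + by apply: (msubset_subset S'Y'); apply: mem_tnth.
- rewrite big_seq; apply: (big_ind (fun x : R => x \in V)) => // p; rewrite in_msetB => pS.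
  apply: Vh; rewrite mem_cat; apply/orP; left.
  by rewrite in_mset (leq_ltn_trans _ pS).
- rewrite big_seq; apply: (big_ind (fun x : R => x \in V)) => // p; rewrite in_msetB => pS.
  apply: Vh; rewrite mem_cat; apply/orP; right.
  by rewrite in_mset (leq_ltn_trans _ pS).
Qed.

(* Main.v *)
Require Import Defs.
From mathcomp Require Import all_boot all_order all_algebra.
From mathcomp Require Import finmap multiset.
From mathcomp Require Import lra.
From mathcomp Require Import all_classical all_reals all_analysis.

(** The erosion distance sees a diagram only through its rank function, so
adding one bar [p] to a diagram [Y] costs at most [e] as soon as eroding by [e]
already makes [Y] lose a bar wherever the eroded [p] still counts: this
loss makes up for the extra [1] in the rank.  The bars that do this job may lie
arbitrarily far from [p], since all that matters is where their deaths fall;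
the bottleneck distance, on the contrary, has to pair [p] with a bar nearby or
with the diagonal.

For [n : nat] let [p] be the bar [(-(n+1), n+1)] and [Y] the comb of the [2n]
bars [(-2(n+1), k+1-n)], [k < 2n].  The deaths of the comb run through the
integers from [1-n] to [n], so every query that detects the eroded [p] has a
tooth dying within the next unit of time, and the erosion distance between [Y]
and [Y] with [p] added is at most [1] ([erosion_distance_add]).  But [p] is at
distance at least [n+1] from every tooth and has half-persistence [n+1], so the
bottleneck distance is at least [n+1] ([bottleneck_distance_isolated]).  Hence
no control function tending to infinity, applied to the bottleneck distance,
can stay below the erosion distance. *)

Set Implicit Arguments.
Unset Strict Implicit.
Unset Printing Implicit Defensive.

Import Order.TTheory GRing.Theory Num.Theory.
Import numFieldNormedType.Exports.

Local Open Scope classical_set_scope.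
Local Open Scope ring_scope.

Lemma rank_add (R : realType) (p : half_plane R) (Y : PDgm R) (b d : R) :
  rank (p +` Y)%mset b d =
  (((birth p <= b)%R && (d < death p)%R) + rank Y b d)%N.
Proof.
have /permP pY : perm_eq (enum_mset (p +` Y)%mset) (p :: enum_mset Y).
  by rewrite -{1}[Y]seq_mset_id -mset_cons perm_eq_seq_mset.
by rewrite /rank pY.
Qed.

Lemma rank_erode (R : realType) (Y : PDgm R) (e b d : R) : 0 <= e ->
  (rank Y (b - e) (d + e) <= rank Y b d)%N.
Proof. by move=> e0; apply: sub_count => q /andP[? ?]; lra. Qed.

Lemma rank_erode_lt (R : realType) (Y : PDgm R) (q : half_plane R) (e b d : R) :
  0 <= e -> q \in enum_mset Y ->
  birth q <= b -> d < death q -> death q <= d + e ->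
  (rank Y (b - e) (d + e) < rank Y b d)%N.
Proof.
move=> e0 qY bq dq qe; have /permP qrem := perm_to_rem qY.
rewrite /rank !qrem /= bq dq [d + e < _]ltNge qe andbF add0n add1n ltnS.
by apply: sub_count => r /andP[? ?]; lra.
Qed.

(** The bar [q] counts in the rank of [Y] at [(b, d)] but no longer at
[(b - e, d + e)], and this loss absorbs the contribution of [p]. *)
Lemma erosion_distance_add (R : realType) (p : half_plane R) (Y : PDgm R)
    (e : R) : 0 <= e ->
  (forall b d, b <= d -> birth p <= b - e -> d + e < death p ->
     exists2 q, q \in enum_mset Y &
       [/\ birth q <= b, d < death q & death q <= d + e]) ->
  erosion_distance (p +` Y)%mset Y <= e.
Proof.
move=> e0 teeth; apply: ge_inf; first by exists 0 => ? [].
split=> // b d bd; rewrite rank_add.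
  case: andP => [[bp dp]|_]; last exact: rank_erode.
  have [q qY [bq dq qe]] := teeth _ _ bd bp dp.
  exact: rank_erode_lt qY bq dq qe.
by apply: leq_trans (leq_addl _ _); apply: rank_erode.
Qed.

(** A matching either leaves [p] unmatched or sends it to a bar of [Y'], and
both options cost at least [c]. *)
Lemma bottleneck_distance_isolated (R : realType) (p : half_plane R)
    (Y Y' : PDgm R) (c : R) :
  p \in enum_mset Y -> c <= half_persistence p ->
  (forall q, q \in enum_mset Y' -> c <= dist_infty p q) ->
  c <= bottleneck_distance Y Y'.
Proof.
move=> pY cp far.
have [S [S' [phi [_ S'Y' _ ->]]]] := bottleneck_distance_attained Y Y'.
rewrite /matching_cost !le_max; have [pS|pS] := boolP (p \in enum_mset S).
  have /tnthP[i pi] : p \in in_tuple (enum_mset S) by [].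
  apply/orP; left; apply: le_trans (le_bigmax _ _ i).
  rewrite {1}/mset_point -pi; apply: far.
  by apply: (msubset_subset S'Y'); apply: mem_tnth.
apply/orP; right; apply/orP; left; apply: (le_trans cp).
apply: (@le_bigmax_seq _ _ _ _ _ p) => //.
by rewrite in_msetB (mset_eq0P pS) mset_gt0.
Qed.

Fact long_bar_subproof (R : realType) (n : nat) :
  (- n.+1%:R : R, n.+1%:R : R).1 < (- n.+1%:R : R, n.+1%:R : R).2.
Proof. by have := ltr0Sn R n; rewrite /=; lra. Qed.

Definition long_bar (R : realType) (n : nat) : half_plane R :=
  exist (fun p : R * R => p.1 < p.2) _ (long_bar_subproof R n).

Fact comb_tooth_subproof (R : realType) (n k : nat) :
  (- (2 * n.+1%:R) : R, k.+1%:R - n%:R : R).1 <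
  (- (2 * n.+1%:R) : R, k.+1%:R - n%:R : R).2.
Proof. by rewrite /= -!natr1; have := ler0n R n; have := ler0n R k; lra. Qed.

Definition comb_tooth (R : realType) (n k : nat) : half_plane R :=
  exist (fun p : R * R => p.1 < p.2) _ (comb_tooth_subproof R n k).

Definition comb (R : realType) (n : nat) : PDgm R :=
  seq_mset [seq comb_tooth R n k | k <- iota 0 n.*2].

Lemma mem_comb (R : realType) (n : nat) (q : half_plane R) :
  reflect (exists2 k, (k < n.*2)%N & q = comb_tooth R n k)
          (q \in enum_mset (comb R n)).
Proof.
rewrite (perm_mem (perm_eq_seq_mset _)); apply: (iffP mapP) => -[k kn ->];
by exists k; rewrite // mem_iota in kn *.
Qed.

Lemma erosion_distance_comb (R : realType) (n : nat) :
  erosion_distance (long_bar R n +` comb R n)%mset (comb R n) <= 1.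
Proof.
apply: erosion_distance_add => // b d bd.
rewrite /birth /death /= -natr1 => bb dd.
have d0 : 0 <= d + n%:R by lra.
(* With time counted from [-n], the [k]-th tooth dies at [k.+1]: this is the
   first one still alive at time [d]. *)
pose k := Num.trunc (d + n%:R).
have /andP[kd dk] := truncn_itv d0.
have k2n : (k < n.*2)%N.
  by rewrite truncn_lt_nat// -addnn natrD; lra.
exists (comb_tooth R n k); first by apply/mem_comb; exists k.
rewrite /birth /death /= -!natr1; rewrite -natr1 -/k in dk.
by have := ler0n R n; split; lra.
Qed.

Lemma bottleneck_distance_comb (R : realType) (n : nat) :
  n.+1%:R <= bottleneck_distance (long_bar R n +` comb R n)%mset (comb R n).
Proof.
apply: (@bottleneck_distance_isolated _ (long_bar R n)).
- exact: mset1D1.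
- by rewrite /half_persistence /birth /death /=; lra.
- move=> _ /mem_comb[k _ ->]; rewrite /dist_infty le_max /birth /=.
  by apply/orP; left; apply: le_trans (ler_norm _); lra.
Qed.

Theorem proposition4p1 (R : realType) :
  ~ coarsely_equivalent (@bottleneck_distance R) (@erosion_distance R).
Proof.
move=> [[rho_m [rho_p [_ _ /cvgryPgt /(_ 1) [N [_ rho1]] control]]] _].
pose n := Num.trunc N.
have /andP[+ _] := control (long_bar R n +` comb R n)%mset (comb R n).
apply/negP; rewrite -ltNge.
apply: le_lt_trans (erosion_distance_comb R n) (rho1 _ _).
by apply: lt_le_trans (bottleneck_distance_comb R n); exact: truncnS_gt.
Qed.
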